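(* $\operatorname{add}^*_\omega(\mathrm{nwd})=\operatorname{add}(\mathcal M)$.
   Context: $\mathrm{nwd}$ is the ideal of nowhere dense subsets of $2^{<\omega}$: $A\subseteq2^{<\omega}$ is nowhere dense iff every $s\in2^{<\omega}$ has an extension $t\supseteq s$ in $2^{<\omega}$ such that no extension of $t$ belongs to $A$. For an ideal $\mathscr I$ on a countable set, $\operatorname{add}^*_\omega(\mathscr I)=\min\{|\mathcal A|:\mathcal A\subseteq\mathscr I,\ \forall\overline B\in[\mathscr I]^\omega\,\exists A\in\mathcal A\,\forall B\in\overline B\ A\not\subseteq^*B\}$, where $[\mathscr I]^\omega$ is the set of countably infinite subsets of $\mathscr I$ and $\subseteq^*$ is inclusion modulo finite. $\operatorname{add}(\mathcal M)$ is the additivity of the meager ideal. *)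

(* Defs.v *)
From mathcomp Require Import all_boot.
From mathcomp Require Import boolp classical_sets functions cardinality.
From mathcomp Require Import topology cantor.

Set Implicit Arguments.
Unset Strict Implicit.
Unset Printing Implicit Defensive.

Local Open Scope classical_set_scope.
Local Open Scope card_scope.

(* A cardinal is represented by any set [K] of that cardinality.
   [is_min_card P K] reads |K| = min {|A| : A in P}, and in particular says that
   the minimum is attained. *)
Definition is_min_card (X : Type) (P : set (set X)) (U : Type) (K : set U) :
    Prop :=
  (exists2 A, P A & A #= K) /\ (forall A, P A -> K #<= A).

Definition almost_subset (T : Type) (A B : set T) : Prop :=
  finite_set (A `\` B).

Definition is_add_star_omega (T : countType) (I : set (set T))
    (U : Type) (K : set U) : Prop :=
  is_min_card
    [set AA : set (set T) | AA `<=` I /\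
      forall BB : set (set T), BB `<=` I -> BB #= [set: nat] ->
        exists2 A, AA A & forall B, BB B -> ~ almost_subset A B] K.

Definition is_add (T : Type) (I : set (set T)) (U : Type) (K : set U) : Prop :=
  is_min_card
    [set AA : set (set T) | AA `<=` I /\ ~ I (\bigcup_(A in AA) A)] K.

(* 2^{<omega} is [seq bool], ordered by end-extension: [prefix s t] means that
   t extends s. *)
Definition nwd : set (set (seq bool)) :=
  [set A | forall s, exists2 t, prefix s t & forall u, prefix t u -> ~ A u].

Definition nowhere_dense (T : topologicalType) (A : set T) : Prop :=
  interior (closure A) = set0.

Definition meager (T : topologicalType) : set (set T) :=
  [set A | exists2 F : nat -> set T,
    (forall n, nowhere_dense (F n)) & A = \bigcup_n F n].

Arguments meager : clear implicits.

(* Main.v *)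
Require Import Defs.
From mathcomp Require Import all_boot.
From mathcomp Require Import boolp classical_sets functions cardinality.
From mathcomp Require Import topology cantor.

Set Implicit Arguments.
Unset Strict Implicit.
Unset Printing Implicit Defensive.

(* Call a family of nowhere dense subsets of 2^{<omega} unbounded if it
   witnesses add*_omega(nwd). If M is the union of nowhere dense sets F_n, let
   T_M be the union of the sets 0^n 1 T(F_n), where T(F) is the tree of initial
   segments of F. Then T_M is nowhere dense, and if T_M is almost contained in a
   nowhere dense B, then M is contained in a meager set that depends only on B.
   So a family of meager sets with nonmeager union yields an unbounded family of
   no larger cardinality.

   Conversely, let AA be a family of size less than add(M). The sets of branches
   x all of whose initial segments have an extension in A, for A in AA, are
   nowhere dense, so for each s there is x_s extending s outside all of them.
   Let f_A(s) be a length at which the cone of x_s misses A. A second use of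
   additivity, for the closed sets of branches that take the value 1 in each
   interval [n, g(n)], bounds all functions f_A by countably many functions h,
   and the complement of the cones of the x_s at level h(s) is a nowhere dense
   set that contains A whenever f_A <= h. *)

Local Open Scope classical_set_scope.
Local Open Scope card_scope.

(* Zorn's lemma, applied to sets of choice functions on [P] that pairwise differ
   at every coordinate: a maximal such set projects onto some [A] in [P], for
   otherwise one more function could be added. *)
Lemma ex_min_card (V : pointedType) (P : set (set V)) :
  P !=set0 -> exists2 A, P A & forall B, P B -> A #<= B.
Proof.
move=> [A0 PA0].
pose J : set (set (set V -> V)) := [set G |
  (forall phi, G phi -> forall A, P A -> A (phi A)) /\
  (forall phi psi, G phi -> G psi -> forall A, P A ->
    phi A = psi A -> phi = psi)].
have [F FJ totF|G [[GA Ginj] maxG]] := @Zorn_bigcup _ J.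
  split=> [phi [G FG Gphi]|phi psi [G FG Gphi] [H FH Hpsi]].
    by have [+ _] := FJ _ FG; exact.
  have [GH|HG] := totF _ _ FG FH.
    by have [_ +] := FJ _ FH; apply=> //; exact: GH.
  by have [_ +] := FJ _ FG; apply=> //; exact: HG.
have [[A PA surjA]|noA] := pselect (exists2 A, P A &
    forall a, A a -> exists2 phi, G phi & phi A = a).
  exists A => // B PB.
  (* Evaluating at [B] a function of [G] that takes the value [a] at [A] gives the injection of [A]
     into [B]. *)
  have /choice[c cP] : forall a, exists phi, A a -> G phi /\ phi A = a.
    move=> a; have [/surjA[phi]|] := pselect (A a); first by exists phi.
    by exists (cst point).
  apply/pcard_leP/injfunPex; exists (fun a => c a B).
    by move=> a Aa; apply: GA PB; have [] := cP a Aa.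
  move=> a b /set_mem Aa /set_mem Ab cab.
  have [[Gca <-] [Gcb <-]] := (cP a Aa, cP b Ab).
  by rewrite (Ginj _ _ Gca Gcb B PB cab).
have /choice[psi psiP] : forall A, exists a, P A ->
    A a /\ forall phi, G phi -> phi A <> a.
  move=> A; have [PA|] := pselect (P A); last by exists point.
  apply: contrapT => noa; apply: noA; exists A => // a Aa.
  apply: contrapT => nophi; apply: noa; exists a => _; split=> // phi Gphi phiA.
  by apply: nophi; exists phi.
exfalso; apply: (maxG (G `|` [set psi])).
  split; first by move=> phi; left.
  by move=> /(_ psi (or_intror erefl)) Gpsi; have [_ /(_ _ Gpsi)] := psiP _ PA0.
split=> [phi [/GA//|-> A PA]|phi phi']; first by have [] := psiP A PA.
move=> [Gphi|->] [Gphi'|->] A PA //.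
- exact: Ginj.
- by have [_ /(_ _ Gphi)] := psiP A PA.
- by move=> /esym; have [_ /(_ _ Gphi')] := psiP A PA.
Qed.

(** * Finite strings and the topology of the Cantor space *)

Lemma take_mkseq (T : Type) (x : nat -> T) m n :
  m <= n -> take m (mkseq x n) = mkseq x m.
Proof. by move=> mn; rewrite /mkseq -map_take take_iota (minn_idPl mn). Qed.

Lemma prefix_mkseq (T : eqType) (x : nat -> T) m n :
  m <= n -> prefix (mkseq x m) (mkseq x n).
Proof. by move=> mn; rewrite prefixE size_mkseq take_mkseq. Qed.

Lemma mkseq_prefix (T : eqType) (x : nat -> T) n s :
  prefix s (mkseq x n) -> mkseq x (size s) = s.
Proof.
move=> psn; have := size_prefix psn; rewrite size_mkseq => sn.
by move: psn; rewrite prefixE take_mkseq // => /eqP.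
Qed.

Definition cylinder (s : seq bool) : set cantor_space :=
  [set x | mkseq x (size s) = s].

Lemma cylinder_nth s : cylinder s (nth false s).
Proof. exact: mkseq_nth. Qed.

Lemma cylinder_prefix s t : prefix s t -> cylinder t `<=` cylinder s.
Proof. by move=> pst x tx; apply: (@mkseq_prefix _ x (size t)); rewrite tx. Qed.

Lemma cylinder_rcons s b x : cylinder (rcons s b) x -> x (size s) = b.
Proof.
by rewrite /cylinder /= size_rcons mkseqS => /rcons_inj[_].
Qed.

(** A basic neighbourhood in the product topology constrains finitely many coordinates, and these
    lie in an initial segment. *)
Lemma nbhs_cylinderP (x : cantor_space) (A : set cantor_space) :
  nbhs x A <-> exists n, cylinder (mkseq x n) `<=` A.
Proof.
split=> [|[n nA]].
  pose F := filter_from [set: nat] (fun n => cylinder (mkseq x n)).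
  have FF : Filter F.
    apply: filter_from_filter; first by exists 0.
    move=> i j _ _; exists (maxn i j) => //.
    by rewrite subsetI; split; apply: cylinder_prefix; apply: prefix_mkseq;
      rewrite ?leq_maxl ?leq_maxr.
  have : F --> x.
    apply/cvg_sup => i; apply/cvg_image.
      by apply/seteqP; split=> // b _; exists (fun=> b).
    move=> W xW; exists [set y | W (y i)].
      exists i.+1 => // y; rewrite /cylinder /mkset size_mkseq !mkseqS.
      by move=> /rcons_inj[_] ->; exact: nbhs_singleton xW.
    by apply/seteqP; split=> [_ [y Wy <-]//|b Wb]; exists (fun=> b).
  by move=> /[apply] -[n _ nA]; exists n.
suff cyln m : nbhs x (cylinder (mkseq x m)) by exact: filterS (cyln n).
elim: m => [|m IHm]; first by apply: filterS filterT => y _.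
have xm : nbhs x [set y : cantor_space | y m = x m].
  exact: (@proj_continuous nat (fun=> bool) m x _ (discrete_set1 (x m))).
apply: filterS2 IHm xm => y; rewrite /cylinder /mkset !size_mkseq !mkseqS.
by move=> -> ->.
Qed.

Lemma cylinder_nbhs s (x : cantor_space) : cylinder s x -> nbhs x (cylinder s).
Proof. by move=> sx; apply/nbhs_cylinderP; exists (size s); rewrite sx. Qed.

(** This gives nowhere density the combinatorial form of [nwd], with cylinders in place of cones of
    strings. *)
Lemma nowhere_denseP (F : set cantor_space) : nowhere_dense F <->
  forall s, exists2 t, prefix s t & forall x, F x -> ~ cylinder t x.
Proof.
split=> [Fnd s|Fnd].
  have [y sy nFy] : exists2 y, cylinder s y & ~ closure F y.
    apply: contrapT => noy; suff : interior (closure F) (nth false s).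
      by rewrite Fnd.
    apply: filterS (cylinder_nbhs (cylinder_nth s)) => y sy.
    by apply: contrapT => nFy; apply: noy; exists y.
  have /nbhs_cylinderP[n nF] : nbhs y (~` F).
    by rewrite -[nbhs _ _]/(interior (~` F) y) interiorC.
  exists (mkseq y (maxn n (size s))).
    by rewrite -{1}sy; apply: prefix_mkseq; rewrite leq_maxr.
  move=> x Fx xn; apply: (nF x) => //; apply: cylinder_prefix xn.
  by apply: prefix_mkseq; rewrite leq_maxl.
apply/seteqP; split=> // x /nbhs_cylinderP[n nF].
have [t nt tF] := Fnd (mkseq x n).
have /nF tcl := cylinder_prefix nt (cylinder_nth t).
have [y [Fy ty]] := tcl _ (cylinder_nbhs (cylinder_nth t)).
exact: tF Fy ty.
Qed.

(** * Baire category and meager sets *)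

(* The Rasiowa-Sikorski lemma, with conditions [P] and dense sets [D n]. *)
Lemma generic_branch (P : set (seq bool)) (D : nat -> set (seq bool)) s :
  P s ->
  (forall n u, P u ->
    exists t, [/\ prefix u t, size u < size t, P t & D n t]) ->
  exists2 x, cylinder s x &
    forall n, exists t, [/\ n < size t, P t, D n t & cylinder t x].
Proof.
move=> Ps DP.
have /choice[f fP] : forall nu : nat * seq bool, exists t, P nu.2 ->
    [/\ prefix nu.2 t, size nu.2 < size t, P t & D nu.1 t].
  move=> [n u]; have [/(DP n)[t]|] := pselect (P u); first by exists t.
  by exists [::].
pose fix t n := if n is m.+1 then f (m, t m) else s.
have Pt n : P (t n) by elim: n => //= n /(fP (n, _))[].
have tS n : prefix (t n) (t n.+1) by have [] := fP (n, t n) (Pt n).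
have sz n : n <= size (t n).
  elim: n => //= n IHn; have [_ + _ _] := fP (n, t n) (Pt n).
  exact: leq_ltn_trans.
have tmono m n : m <= n -> prefix (t m) (t n).
  elim: n => [|n IHn]; first by rewrite leqn0 => /eqP->; exact: prefix_refl.
  rewrite leq_eqVlt => /orP[/eqP->|/IHn mn]; first exact: prefix_refl.
  exact: prefix_trans mn (tS n).
have nthE m n i : i < size (t m) -> i < size (t n) ->
    nth false (t m) i = nth false (t n) i.
  wlog mn : m n / m <= n => [H im iN|im _].
    by have [mn|/ltnW nm] := leqP m n; [|symmetry]; exact: H.
  by have /prefixP[v ->] := tmono _ _ mn; rewrite nth_cat im.
(* The limit branch reads digit [i] from [t i.+1], which has length greater than [i]. *)
have xP n : cylinder (t n) (fun i => nth false (t i.+1) i).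
  apply: (@eq_from_nth _ false); rewrite size_mkseq // => i iN.
  by rewrite nth_mkseq //; apply: nthE => //; exact: sz.
exists (fun i => nth false (t i.+1) i); first exact: (xP 0).
move=> n; exists (t n.+1); have [_ _ _ Dt] := fP (n, t n) (Pt n).
by split=> //; exact: sz.
Qed.

Lemma cantor_baire (F : nat -> set cantor_space) s :
  (forall n, nowhere_dense (F n)) ->
  exists2 x, cylinder s x & ~ (\bigcup_n F n) x.
Proof.
move=> Fnd.
have [//|n u _|x sx xP] := @generic_branch setT
    (fun n t => forall x, F n x -> ~ cylinder t x) s.
  have /nowhere_denseP/(_ (rcons u true))[t ut tF] := Fnd n.
  exists t; split=> //; first exact: prefix_trans (prefix_rcons _ _) ut.
  by have := size_prefix ut; rewrite size_rcons.
exists x => // -[n _ Fnx]; have [t [_ _ tF tx]] := xP n.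
exact: tF Fnx tx.
Qed.

Lemma sub_nowhere_dense (F G : set cantor_space) :
  F `<=` G -> nowhere_dense G -> nowhere_dense F.
Proof.
move=> FG /nowhere_denseP Gnd; apply/nowhere_denseP => s.
by have [t st tG] := Gnd s; exists t => // x /FG; exact: tG.
Qed.

Lemma nowhere_dense0 : nowhere_dense (set0 : set cantor_space).
Proof. by apply/nowhere_denseP => s; exists s; first exact: prefix_refl. Qed.

Lemma nowhere_dense1 (x : cantor_space) : nowhere_dense [set x].
Proof.
apply/nowhere_denseP => s; exists (rcons s (~~ x (size s))).
  exact: prefix_rcons.
by move=> _ -> /cylinder_rcons; case: (x _).
Qed.

(** [meager] asks for equality with a union over [nat]; cutting each [F i] down to [A] turns a
    countable cover into one. *)
Lemma sub_bigcup_meager (I : countType) (F : I -> set cantor_space) A :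
  (forall i, nowhere_dense (F i)) -> A `<=` \bigcup_i F i ->
  meager cantor_space A.
Proof.
move=> Fnd AF.
exists (fun n => if unpickle n is Some i then F i `&` A else set0).
  move=> n; case: unpickle => [i|]; last exact: nowhere_dense0.
  by apply: sub_nowhere_dense (Fnd i) => x [].
apply/seteqP; split=> [x Ax|x [n _]]; last by case: unpickle => // i [].
by have [i _ Fix] := AF _ Ax; exists (pickle i) => //; rewrite pickleK.
Qed.

Lemma nowhere_dense_meager (F : set cantor_space) :
  nowhere_dense F -> meager cantor_space F.
Proof.
move=> Fnd; apply: (@sub_bigcup_meager unit (fun=> F)) => // x Fx.
by exists tt.
Qed.

Lemma not_meagerT : ~ meager cantor_space [set: cantor_space].
Proof.
by move=> [F Fnd FT]; have [x _] := cantor_baire [::] Fnd; rewrite -FT; apply.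
Qed.

(** * From nonmeager unions to unbounded families *)

Definition omega_unbounded : set (set (set (seq bool))) :=
  [set AA | AA `<=` nwd /\
    forall BB : set (set (seq bool)), BB `<=` nwd -> BB #= [set: nat] ->
      exists2 A, AA A & forall B, BB B -> ~ almost_subset A B].

Definition nonmeager_union : set (set (set cantor_space)) :=
  [set MM | MM `<=` meager cantor_space /\
    ~ meager cantor_space (\bigcup_(M in MM) M)].

(** The definition tests only countably infinite families; adding infinitely many singletons extends
    the test to any countably indexed one. *)
Lemma omega_unboundedP AA (I : countType) (B : I -> set (seq bool)) :
  omega_unbounded AA -> (forall i, nwd (B i)) ->
  exists2 A, AA A & forall i, ~ almost_subset A (B i).
Proof.
move=> [_ AAunb] Bnwd.
pose sing n := [set nseq n true].
have [||A AAA AB] := AAunb (range B `|` range sing).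
- move=> _ [[i _ <-]//|[n _ <-]] s; exists (rcons s false).
    exact: prefix_rcons.
  move=> u /prefixP[v ->] /(congr1 (fun w => false \in w)).
  by rewrite mem_cat mem_rcons mem_head mem_nseq andbF.
- apply: Cantor_Bernstein.
    have -> : range B `|` range sing =
        range (fun i => match i with inl i => B i | inr n => sing n end).
      apply/seteqP; split=> [_ [[i _ <-]|[n _ <-]]|_ [[i|n] _ <-]].
      - by exists (inl i).
      - by exists (inr n).
      - by left; exists i.
      - by right; exists n.
    exact: sub_countable (card_image_le _ _) (countableP _).
  apply: card_le_trans (subset_card_le (@subsetUr _ _ _)).
  apply/pcard_leP/injfunPex; exists sing => [n _|m n _ _ mn]; first by exists n.
  have : sing n (nseq m true) by rewrite -mn.
  by move=> /(congr1 size); rewrite !size_nseq.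
by exists A => // i; apply: AB; left; exists i.
Qed.

Lemma nseq_true_prefix m n s t :
  prefix (nseq m false ++ true :: s) (nseq n false ++ true :: t) ->
  m = n /\ prefix s t.
Proof.
by elim: m n => [|m IHm] [|n] //= /IHm[->].
Qed.

Lemma mem_true_split s : true \in s ->
  exists n t, s = nseq n false ++ true :: t.
Proof.
elim: s => //= -[] s IHs; first by exists 0, s.
by rewrite inE => /IHs[n [t ->]]; exists n.+1, t.
Qed.

Lemma finite_seq_size (T : choiceType) (A : set (seq T)) :
  finite_set A -> exists N, forall u, A u -> size u < N.
Proof.
move=> /finite_seqP[s ->]; exists (\max_(u <- s) size u).+1 => u us.
by rewrite ltnS; exact: leq_bigmax_seq.
Qed.

(* [F_n |-> 0^n 1 (tree of F_n)] codes a meager union of the [F_n] by a single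
   nowhere dense subset of 2^{<omega}. *)
Lemma omega_unbounded_of_nonmeager MM : nonmeager_union MM ->
  exists2 AA, omega_unbounded AA & AA #<= MM.
Proof.
move=> [MMmeager MMunion].
have /choice[F FP] : forall M, exists F : nat -> set cantor_space,
    MM M -> (forall n, nowhere_dense (F n)) /\ M = \bigcup_n F n.
  move=> M; have [/MMmeager[F Fnd ->]|] := pselect (MM M); first by exists F.
  by exists (fun=> set0).
pose T M := [set u | exists n k x,
  F M n x /\ u = nseq n false ++ true :: mkseq x k].
exists (T @` MM); last exact: card_image_le.
split=> [_ [M /FP[Fnd _] <-] s|BB BBnwd BBcard].
  (* The appended [true] ensures that the string has the form 0^n 1 v. *)
  have [|n [v sv]] := @mem_true_split (rcons s true).
    by rewrite mem_rcons mem_head.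
  have /nowhere_denseP/(_ v)[t vt tF] := Fnd n.
  exists (nseq n false ++ true :: t).
    apply: prefix_trans (prefix_rcons s true) _; rewrite sv.
    by have /prefixP[w ->] := vt; rewrite -cat_cons catA prefix_prefix.
  move=> u tu [m [k [x [Fmx ux]]]]; move: tu; rewrite ux.
  by move=> /nseq_true_prefix[nm /mkseq_prefix]; apply: tF; rewrite nm.
have /card_eqPle[/pcard_surjP[e eBB] _] := BBcard.
apply: contrapT => noA; apply: MMunion.
(* In a triple, the first entry selects a member of [BB], the second a row of the code, and the
   third a length beyond the finitely many exceptions. *)
pose D (i : nat * nat * nat) := [set x : cantor_space | BB (e i.1.1) /\
  forall k, i.2 <= k -> e i.1.1 (nseq i.1.2 false ++ true :: mkseq x k)].
apply: (@sub_bigcup_meager _ D) => [[[i n] N]|x [M MMM Mx]].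
  have [BBe|nBBe] := pselect (BB (e i)); last first.
    by apply: sub_nowhere_dense nowhere_dense0 => x [].
  apply/nowhere_denseP => s.
  (* The [N] zeros make the part after the marker long enough for the condition in [D] to apply. *)
  have [t st te] := BBnwd _ BBe (nseq n false ++ true :: s ++ nseq N false).
  have /prefixP[w tw] := st.
  have tE : t = nseq n false ++ true :: (s ++ nseq N false) ++ w.
    by rewrite tw -[LHS]catA.
  exists ((s ++ nseq N false) ++ w); first by rewrite -catA prefix_prefix.
  move=> x [_ /= xe] tx; apply: (te t); first exact: prefix_refl.
  rewrite tE -tx; apply: xe.
  by rewrite !size_cat size_nseq addnAC leq_addl.
have [B BBB TB] : exists2 B, BB B & almost_subset (T M) B.
  apply: contrapT => noB; apply: noA; exists (T M); first by exists M.
  by move=> B BBB TB; apply: noB; exists B.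
have [i _ ei] := eBB _ BBB.
have [Fnd ME] := FP _ MMM.
move: Mx; rewrite ME => -[n _ Fnx].
have [N NP] := finite_seq_size TB.
exists (i, n, N) => //; split=> /=; first by rewrite ei.
move=> k Nk; rewrite ei; apply: contrapT => nB.
have /NP : (T M `\` B) (nseq n false ++ true :: mkseq x k).
  by split=> //; exists n, k, x.
rewrite size_cat /= size_mkseq size_nseq ltnNge => /negP; apply.
by rewrite (leq_trans Nk)// -addSnnS leq_addl.
Qed.

(** * Domination through closed nowhere dense sets *)

Definition catcher (g : nat -> nat) : set cantor_space :=
  [set x | forall n, exists2 m, n <= m <= g n & x m].

(** Zeros from [size s] through [g (size s)] leave one interval without a one. *)
Lemma catcher_nowhere_dense g : nowhere_dense (catcher g).
Proof.
apply/nowhere_denseP => s.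
exists (s ++ nseq (g (size s)).+1 false); first exact: prefix_prefix.
move=> x /(_ (size s))[m /andP[sm mg] xm] sx.
suff : x m = false by rewrite xm.
have mS : m < size (s ++ nseq (g (size s)).+1 false).
  by rewrite size_cat size_nseq addnS ltnS (leq_trans mg)// leq_addl.
by rewrite -(nth_mkseq false x mS) sx nth_cat ltnNge sm nth_nseq if_same.
Qed.

(** Each length has only finitely many strings, so the bound can depend on the length alone. *)
Lemma avoiding_extension_bound (F : set cantor_space) : nowhere_dense F ->
  exists h : nat -> nat, forall s, exists t,
    [/\ prefix s t, size t <= h (size s) & forall x, F x -> ~ cylinder t x].
Proof.
move=> /nowhere_denseP Fnd.
have /choice[f fP] : forall s, exists t,
    prefix s t /\ forall x, F x -> ~ cylinder t x.
  by move=> s; have [t] := Fnd s; exists t.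
exists (fun m => \max_(s : m.-tuple bool) size (f s)) => s; exists (f s).
have [sf fF] := fP s; split=> //.
exact: (@leq_bigmax _ (fun s0 : (size s).-tuple bool => size (f s0))
  (in_tuple s)).
Qed.

(* If no [F k] contained a relatively open part of the closed set [catcher g],
   a generic branch of it would escape them all. *)
Lemma catcher_dominated (F : nat -> set cantor_space) :
  (forall k, nowhere_dense (F k)) ->
  exists h : nat -> nat -> nat, forall g, {homo g : m n / m <= n} ->
    (forall n, n <= g n) -> catcher g `<=` \bigcup_k F k ->
    exists k c, forall m, c <= m -> g m <= h k m.
Proof.
move=> Fnd.
have /choice[h hP] := fun k => avoiding_extension_bound (Fnd k).
exists h => g gmono gge gF; apply: contrapT => nodom.
(* Every interval starting inside [s] is already met; the default [false] forces the witness to lie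
   inside [s]. *)
pose P : set (seq bool) := [set s | forall n, n < size s ->
  exists2 m, n <= m <= g n & nth false s m].
pose D k t := forall x, F k x -> ~ cylinder t x.
have [//|k u Pu|x _ xP] := @generic_branch P D [::].
  have [m um hm] : exists2 m, size u <= m & h k m < g m.
    apply: contrapT => nom; apply: nodom; exists k, (size u) => m um.
    by rewrite leqNgt; apply/negP => hm; apply: nom; exists m.
  (* Padding with ones meets the new intervals that start before [m]; a last one after [t] meets the
     others. *)
  pose v := u ++ nseq (m - size u) true.
  have vm : size v = m by rewrite size_cat size_nseq subnKC.
  have [t [vt + tF]] := hP k v; rewrite vm => th.
  have ut : prefix u t := prefix_trans (prefix_prefix _ _) vt.
  exists (rcons t true); split.
  - exact: prefix_trans ut (prefix_rcons _ _).
  - by rewrite size_rcons ltnS; exact: size_prefix.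
  - move=> n; rewrite size_rcons ltnS => nt.
    have [nu|un] := ltnP n (size u).
      have [i ni ui] := Pu _ nu; exists i => //.
      have iu : i < size u.
        by rewrite ltnNge; apply: contraTN ui => ui; rewrite nth_default.
      have /prefixP[w tE] := prefix_trans ut (prefix_rcons t true).
      by rewrite tE nth_cat iu.
    have [nm|mn] := ltnP n m.
      exists n; first by rewrite leqnn gge.
      have /prefixP[w tE] := prefix_trans vt (prefix_rcons t true).
      rewrite tE nth_cat vm nm nth_cat ltnNge un /= nth_nseq.
      by rewrite ltn_sub2r // (leq_ltn_trans un).
    exists (size t); last by rewrite nth_rcons ltnn eqxx.
    (* Here [size t <= h k m < g m <= g n], since [m <= n]. *)
    rewrite nt (leq_trans th)// (leq_trans (ltnW hm))//; exact: gmono.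
  - move=> x Fx; move=> /(cylinder_prefix (prefix_rcons _ _)); exact: tF.
suff /gF[k _ Fkx] : catcher g x.
  by have [t [_ _ tF tx]] := xP k; exact: tF Fkx tx.
move=> n; have [t [nt Pt _ tx]] := xP n.
have [m nm tm] := Pt _ nt; exists m => //.
have mt : m < size t.
  by rewrite ltnNge; apply: contraTN tm => tm; rewrite nth_default.
by rewrite -(nth_mkseq false x mt) tx.
Qed.

(** * From unbounded families to nonmeager unions *)

Definition limit_set (A : set (seq bool)) : set cantor_space :=
  [set x | forall k, exists2 u, prefix (mkseq x k) u & A u].

Lemma limit_set_nowhere_dense A : nwd A -> nowhere_dense (limit_set A).
Proof.
move=> Anwd; apply/nowhere_denseP => s; have [t st tA] := Anwd s.
by exists t => // x /(_ (size t))[u + Au] xt; rewrite xt => /tA; apply.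
Qed.

Lemma nonmeager_of_omega_unbounded AA : omega_unbounded AA ->
  exists2 MM, nonmeager_union MM & MM #<= AA.
Proof.
move=> AAunb; have [AAnwd _] := AAunb; apply: contrapT => noMM.
(* By [noMM], at most [AA] many nowhere dense sets have a meager union; this serves for limit sets
   and again for catchers. *)
have cover (Phi : set (seq bool) -> set cantor_space) :
    (forall A, AA A -> nowhere_dense (Phi A)) ->
    exists2 F : nat -> set cantor_space, (forall n, nowhere_dense (F n)) &
      forall A, AA A -> Phi A `<=` \bigcup_n F n.
  move=> Phind; have [F Fnd FE] : meager _ (\bigcup_(M in Phi @` AA) M).
    apply: contrapT => nmeager; apply: noMM; exists (Phi @` AA).
      split=> // _ [A AAA <-]; exact/nowhere_dense_meager/Phind.
    exact: card_image_le.
  by exists F => // A AAA x Ax; rewrite -FE; exists (Phi A).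
have [F Fnd FP] :=
  cover limit_set (fun A AAA => limit_set_nowhere_dense (AAnwd A AAA)).
have /choice[x xP] : forall s, exists x,
    cylinder s x /\ ~ (\bigcup_n F n) x.
  by move=> s; have [x] := cantor_baire s Fnd; exists x.
pose dec i : seq bool := odflt [::] (unpickle i).
have /choice[f fP] : forall A, exists f : nat -> nat, AA A ->
    forall i u, prefix (mkseq (x (dec i)) (f i)) u -> ~ A u.
  move=> A; have [AAA|] := pselect (AA A); last by exists id.
  suff /choice[f fP] : forall i, exists k, forall u,
    prefix (mkseq (x (dec i)) k) u -> ~ A u by exists f.
  (* If no length worked, the chosen branch would lie in [limit_set A], which the [F n] cover. *)
  move=> i; apply: contrapT => nok; have [_] := xP (dec i); apply.
  apply: (FP _ AAA) => k; apply: contrapT => nou; apply: nok; exists k.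
  move=> u xu Au.
  by apply: nou; exists u.
(* Partial sums make [g A] monotone and above [f A]; the summand [n] puts it above the identity. *)
pose g A n := n + \sum_(i < n.+1) f A i.
have gmono A : {homo g A : m n / m <= n}.
  move=> m n mn; rewrite leq_add// -!(big_mkord xpredT).
  by rewrite [leqRHS](big_cat_nat (n := m.+1)) ?leq_addr.
have fg A n : f A n <= g A n by rewrite /g big_ord_recr /= addnA leq_addl.
have [G Gnd GP] :=
  cover (fun A => catcher (g A)) (fun A _ => catcher_nowhere_dense _).
have [h hP] := catcher_dominated Gnd.
(* The term [size (dec i)] keeps the removed cone above [dec i]; the constant [kc.2] will absorb an
   initial segment where domination fails. *)
pose lvl (kc : nat * nat) i := size (dec i) + (h kc.1 i + kc.2).
pose B kc : set (seq bool) :=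
  [set u | forall i, ~~ prefix (mkseq (x (dec i)) (lvl kc i)) u].
have [[k c] s|A AAA AB] := omega_unboundedP (B := B) AAunb.
  have ds : dec (pickle s) = s by rewrite /dec pickleK.
  exists (mkseq (x s) (lvl (k, c) (pickle s))).
    have [sx _] := xP s; rewrite -{1}sx; apply: prefix_mkseq.
    by rewrite /lvl ds leq_addr.
  by move=> u su /(_ (pickle s)); rewrite ds su.
have [k [c kc]] := hP _ (gmono A) (fun n => leq_addr _ n) (GP _ AAA).
(* By monotonicity, [g A c] bounds [g A i] for all [i < c]. *)
apply: (AB (k, g A c)); rewrite /almost_subset.
suff -> : A `\` B (k, g A c) = set0 by exact: finite_set0.
apply/seteqP; split=> // u [Au]; apply=> i; apply/negP => iu.
apply: (fP A AAA i u) Au; apply: prefix_trans iu; apply: prefix_mkseq.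
apply: leq_trans (fg A i) _; apply: leq_trans (leq_addl _ _) => /=.
have [/kc gh|/ltnW/(gmono A) gc] := leqP c i.
  exact: leq_trans gh (leq_addr _ _).
exact: leq_trans gc (leq_addl _ _).
Qed.

Theorem proposition3p6 :
  exists K : set (set (seq bool)),
    is_add_star_omega nwd K /\ is_add (meager cantor_space) K.
Proof.
have [|K Kunb Kmin] := @ex_min_card _ omega_unbounded.
  (* All meager sets together cover the space, singletons being meager, so some unbounded family
     exists. *)
  have [|AA AAunb _] := @omega_unbounded_of_nonmeager (meager cantor_space).
    split=> // TM; apply: not_meagerT; congr (meager _ _): TM.
    apply/seteqP; split=> // x _; exists [set x] => //.
    exact/nowhere_dense_meager/nowhere_dense1.
  by exists AA.
have Kle MM : nonmeager_union MM -> K #<= MM.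
  by move=> /omega_unbounded_of_nonmeager[AA /Kmin]; exact: card_le_trans.
exists K; split; split=> //; first by exists K.
have [MM MMnm MMK] := nonmeager_of_omega_unbounded Kunb.
by exists MM => //; apply: Cantor_Bernstein => //; exact: Kle.
Qed.
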